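(* Let $n\geq 3$ be an integer and let $p(z)=z^n+a_{n-1}z^{n-1}+a_{n-2}z^{n-2}+\ldots+a_1z+a_0$ be a monic polynomial with complex coefficients and $a_0\neq 0$. If $n=3$, set $a_{-1}=0$. If $z\in\mathbb{C}$ is any zero of $p$, then \[\begin{aligned} |z|^2\leq{}& \cos^2 \frac{\pi}{n}+ \frac{1}{4} \left ( |a_{n-1}|+ \sqrt{(1+|a_{n-2}|)^2+ \sum_{j=0,\,j\neq n-2}^{n-1}|a_j|^2}\right)^2\\ &+ \frac{1}{2} \sqrt{(1+|a_{n-4}|)^2+ \sum_{j=0,\,j\neq n-4}^{n-3}|a_j|^2}. \end{aligned}\] *)

(* Defs.v *)
From mathcomp Require Import all_boot all_order all_algebra complex.
From mathcomp Require Import reals trigo.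

Set Implicit Arguments.
Unset Strict Implicit.
Unset Printing Implicit Defensive.

Import GRing.Theory.
Local Open Scope ring_scope.

(* Coefficients indexed by [int], those of negative index being 0: for n = 3
   the index n - 4 is -1, which truncated subtraction on [nat] would turn
   into 0. *)
Definition coefz (K : nzRingType) (p : {poly K}) (j : int) : K :=
  if j is Posz k then p`_k else 0.

(* The modulus as an element of R; the canonical norm `|z| of R[i] is
   [(normc z)%:C], an element of R[i]. *)
Notation modulus z := (ComplexField.Normc.normc z).

(* Main.v *)
(* z is an eigenvalue of the companion matrix C of p, with eigenvector
   v = (1, z, ..., z^(n-1)). Write C = A + B where B is a nilpotent shift of
   size n - 1 and A carries the coefficients of p together with the remaining
   subdiagonal entry 1. From z^2 v = (A^2 + (AB + BA) + B^2) v and the power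
   inequality w(T^2) <= w(T)^2 for the numerical radius w,
     |z|^2 <= w(A)^2 + w(AB + BA) + w(B)^2,
   and the three summands are estimated by explicit quadratic forms in the
   moduli: w(B) by cos(pi / n), the other two by Cauchy-Schwarz. *)
Require Import Defs.
From mathcomp Require Import all_boot all_order all_algebra complex.
From mathcomp Require Import ring lra zify.
From mathcomp Require Import boolp reals trigo.

Import Order.TTheory GRing.Theory Num.Theory.
Local Open Scope ring_scope.

(** * Upper bounds for the real quadratic forms of a star and of a path *)

Section RealQuadraticForms.
Variable R : realType.

(* Completing squares: [D + a] times the difference of the two sides of the
   doubled inequality, [D] being the square root, is
   [\sum_j ((D + a) * t j - s * c j) ^+ 2]. *)
Lemma star_form_le (k : nat) (a s : R) (c t : nat -> R) :
  0 <= a -> 0 < \sum_(0 <= j < k) c j ^+ 2 ->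
  a * s ^+ 2 + s * \sum_(0 <= j < k) c j * t j <=
    2^-1 * (a + Num.sqrt (a ^+ 2 + \sum_(0 <= j < k) c j ^+ 2)) *
    (s ^+ 2 + \sum_(0 <= j < k) t j ^+ 2).
Proof.
move=> a0 c0; set C := \sum_(0 <= j < k) c j ^+ 2.
set T := \sum_(0 <= j < k) t j ^+ 2; set CT := \sum_(0 <= j < k) c j * t j.
set D := Num.sqrt _.
have D2 : D ^+ 2 = a ^+ 2 + C by rewrite sqr_sqrtr// addr_ge0 ?sqr_ge0// ltW.
have D0 : 0 < D by rewrite sqrtr_gt0 ltr_wpDl// sqr_ge0.
have : 0 <= \sum_(0 <= j < k) ((D + a) * t j - s * c j) ^+ 2.
  by apply: sumr_ge0 => j _; exact: sqr_ge0.
have -> : \sum_(0 <= j < k) ((D + a) * t j - s * c j) ^+ 2 =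
    (D + a) ^+ 2 * T - 2 * s * (D + a) * CT + s ^+ 2 * C.
  rewrite !mulr_sumr -sumrB -big_split /=; apply: eq_bigr => j _; ring.
(* Since [C] is (D - a)(D + a), the positive factor [D + a] can be divided out of the whole sum. *)
have -> : C = D ^+ 2 - a ^+ 2 by rewrite D2; ring.
have -> : (D + a) ^+ 2 * T - 2 * s * (D + a) * CT + s ^+ 2 * (D ^+ 2 - a ^+ 2) =
    (D + a) * ((D + a) * T - 2 * s * CT + s ^+ 2 * (D - a)) by ring.
rewrite pmulr_rge0; last by lra.
lra.
Qed.

(* With [v j = sin (j * pi / k.+2)] one has [v j + v j.+2 = 2 * c * v j.+1], and
   [2 * t j * t j.+1 <=
      v j.+2 / v j.+1 * t j ^+ 2 + v j.+1 / v j.+2 * t j.+1 ^+ 2];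
   summing over [j < k] gives the claim, as [v 0 = v k.+2 = 0]. *)
Lemma path_form_le (k : nat) (t : nat -> R) :
  \sum_(0 <= j < k) t j * t j.+1 <=
    cos (pi / k.+2%:R) * \sum_(0 <= j < k.+1) t j ^+ 2.
Proof.
set c := cos _; pose v (j : nat) : R := sin (j%:R * (pi / k.+2%:R)).
have vrec j : v j + v j.+2 = 2 * c * v j.+1.
  rewrite /v /c; set h := pi / _.
  have -> : j%:R * h = j.+1%:R * h - h by rewrite -natr1; ring.
  have -> : j.+2%:R * h = j.+1%:R * h + h by rewrite -[j.+2%:R]natr1; ring.
  rewrite sinB sinD; ring.
have v_gt0 j : (j <= k)%N -> 0 < v j.+1.
  move=> jk; apply: sin_gt0_pi; apply/andP; split.
    by rewrite mulr_gt0 ?divr_gt0 ?pi_gt0 ?ltr0n.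
  rewrite mulrA ltr_pdivrMr ?ltr0n// mulrC ltr_pM2l ?pi_gt0//.
  by rewrite ltr_nat ltnS ltnS.
have v0 : v 0%N = 0 by rewrite /v mul0r sin0.
have vk : v k.+2 = 0.
  by rewrite /v mulrCA divff ?mulr1 ?sinpi// pnatr_eq0.
(* The edges before [j] leave a boundary term in [t j ^+ 2]; at [j = k] its coefficient is [2 * c],
   because [v k.+2 = 0]. *)
have main j : (j <= k)%N -> 2 * \sum_(0 <= i < j) t i * t i.+1 <=
    2 * c * \sum_(0 <= i < j) t i ^+ 2 + v j / v j.+1 * t j ^+ 2.
  elim: j => [|j IH] jk; first by rewrite !big_geq// v0 !mul0r !mulr0 addr0.
  rewrite !big_nat_recr//= !mulrDr.
  have := IH (ltnW jk).
  have p1 := v_gt0 j (ltnW jk); have p2 := v_gt0 _ jk.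
  have r1 := vrec j.
  suff : 2 * (t j * t j.+1) <=
      2 * c * t j ^+ 2 - v j / v j.+1 * t j ^+ 2
      + v j.+1 / v j.+2 * t j.+1 ^+ 2 by lra.
  rewrite -subr_ge0.
  have -> : v j = 2 * c * v j.+1 - v j.+2 by rewrite -r1; ring.
  set x := v j.+1 in p1 *; set y := v j.+2 in p2 *.
  suff -> : 2 * c * t j ^+ 2 - (2 * c * x - y) / x * t j ^+ 2
      + x / y * t j.+1 ^+ 2 - 2 * (t j * t j.+1) =
      (y * t j - x * t j.+1) ^+ 2 / (x * y).
    by rewrite divr_ge0 ?sqr_ge0// mulr_ge0// ltW.
  by field; rewrite ?gt_eqF.
have := main k (leqnn k); rewrite big_nat_recr//= mulrDr.
have -> : v k = 2 * c * v k.+1 by rewrite -vrec vk addr0.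
by rewrite mulfK ?gt_eqF ?v_gt0//; lra.
Qed.

End RealQuadraticForms.

(** * Real inner products and numerical ranges on complex sequences *)

Section Vectors.
Variable R : realType.
Implicit Types (x y : nat -> R[i]).
Local Open Scope complex_scope.

Lemma ler_norm_Re_mulJ (a b : R[i]) :
  `|complex.Re (a * b^*)| <= modulus a * modulus b.
Proof.
have J : modulus b^* = modulus b by case: b => c d /=; rewrite sqrrN.
rewrite -J -ComplexField.Normc.normcM -ler_sqr ?nnegrE ?normr_ge0//; last first.
  by case: (_ * _) => c d /=; exact: sqrtr_ge0.
case: (_ * _) => c d /=; rewrite real_normK ?num_real// sqr_sqrtr.
  by rewrite lerDl sqr_ge0.
by rewrite addr_ge0 ?sqr_ge0.
Qed.

Lemma modulus_ge0 (a : R[i]) : 0 <= modulus a.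
Proof. by case: a => c d /=; exact: sqrtr_ge0. Qed.

Lemma modulus_sum_le (k : nat) (f : nat -> R[i]) :
  modulus (\sum_(0 <= j < k) f j) <= \sum_(0 <= j < k) modulus (f j).
Proof.
elim: k => [|k IH]; first by rewrite !big_geq// ComplexField.Normc.normc0.
by rewrite !big_nat_recr//=; apply: le_trans (le_normcD _ _) _; rewrite lerD2r.
Qed.

(** Real part of the Hermitian product: being symmetric and bilinear over the reals, it reduces the
    power inequality to a polarisation. *)
Definition redot (n : nat) x y : R :=
  \sum_(0 <= j < n) complex.Re (x j * (y j)^*).

Definition lincomb (a : R) x (b : R) y : nat -> R[i] :=
  fun j => a%:C * x j + b%:C * y j.

Definition real_linear (T : (nat -> R[i]) -> nat -> R[i]) :=
  forall a b x y, T (lincomb a x b y) = lincomb a (T x) b (T y).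

Lemma redotC n x y : redot n x y = redot n y x.
Proof.
by apply: eq_bigr => j _; case: (x j) (y j) => a b [c d] /=; ring.
Qed.

Lemma redotl n a x b y z :
  redot n (lincomb a x b y) z = a * redot n x z + b * redot n y z.
Proof.
rewrite /redot !mulr_sumr -big_split /=; apply: eq_bigr => j _.
by rewrite /lincomb; case: (x j) (y j) (z j) => ? ? [? ?] [? ?] /=; ring.
Qed.

Lemma redotr n a x b y z :
  redot n z (lincomb a x b y) = a * redot n z x + b * redot n z y.
Proof. by rewrite redotC redotl !(redotC n z). Qed.

Lemma redotxx n x : redot n x x = \sum_(0 <= j < n) modulus (x j) ^+ 2.
Proof.
apply: eq_bigr => j _; case: (x j) => a b /=.
by rewrite sqr_sqrtr ?addr_ge0 ?sqr_ge0//; ring.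
Qed.

(* The power inequality w(T^2) <= w(T)^2 for the numerical radius: add the
   hypotheses on [w x + T x] and [w x - T x]. *)
Lemma numerical_radius_sqr n T w x : real_linear T -> 0 < w ->
  (forall y, `|redot n (T y) y| <= w * redot n y y) ->
  redot n (T (T x)) x <= w ^+ 2 * redot n x x.
Proof.
move=> linT w0 hT.
have := hT (lincomb w x 1 (T x)); rewrite ler_norml => /andP[_].
have := hT (lincomb w x (-1) (T x)); rewrite ler_norml => /andP[+ _].
rewrite !linT !redotl !redotr (redotC n x (T x)) => h1 h2.
(* [redot n (T x) (T x)] cancels within each of [h1] and [h2]; the terms [redot n (T x) x] and
   [redot n (T (T x)) (T x)] cancel in their sum. *)
rewrite -(ler_pM2l w0); lra.
Qed.

End Vectors.

(** * The rotated companion matrix of size n = m + 3 and its splitting *)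

Section CompanionMatrix.
Variables (R : realType) (m : nat) (a : nat -> R[i]) (u : R[i]).
Hypothesis u1 : modulus u = 1.
Implicit Types (x y : nat -> R[i]).
Local Open Scope complex_scope.

(* [u] times the companion matrix of 'X^m.+3 + \sum_j a j 'X^j, acting on
   (1, z, ..., z^m.+2), is [top_part + shift_part], i.e. u A + u B. The rotation
   [u] will be chosen with [u * z = |z|], so that only real parts matter. *)
Definition top_part y : nat -> R[i] := fun i =>
  if i == m.+2 then u * - \sum_(0 <= j < m.+3) a j * y j
  else if i == m.+1 then u * y m.+2 else 0.

Definition shift_part y : nat -> R[i] := fun i =>
  if (i < m.+1)%N then u * y i.+1 else 0.

Lemma top_part_linear : real_linear R top_part.
Proof.
move=> c d x y; apply/funext => i; rewrite /top_part /lincomb.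
case: ifP => _; last by case: ifP => _; ring.
have -> : \sum_(0 <= j < m.+3) a j * (c%:C * x j + d%:C * y j) =
    c%:C * (\sum_(0 <= j < m.+3) a j * x j)
    + d%:C * (\sum_(0 <= j < m.+3) a j * y j).
  by rewrite !mulr_sumr -big_split /=; apply: eq_bigr => j _; ring.
ring.
Qed.

(** Index shift with a_{-1} = 0, caused by composing with B; [prev_coef m] is a_{n-4}, also for n =
    3. *)
Definition prev_coef (j : nat) : R[i] := if j is k.+1 then a k else 0.

Lemma modulus_prev_coef0 : modulus (prev_coef 0) = 0.
Proof. exact: ComplexField.Normc.normc0. Qed.

Lemma top_part0 y j : (j < m.+1)%N -> top_part y j = 0.
Proof. by move=> jm; rewrite /top_part !ltn_eqF// ltnW. Qed.

Lemma shift_part0 y j : (m < j)%N -> shift_part y j = 0.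
Proof. by rewrite /shift_part ltnS ltnNge => /negbTE ->. Qed.

Lemma shift_part_linear : real_linear R shift_part.
Proof.
move=> c d x y; apply/funext => i; rewrite /shift_part /lincomb.
by case: ifP => _; ring.
Qed.

(** In moduli, B gives a path on the first n - 1 coordinates, whence the angle pi / n. The last
    coordinate can be added on the right because the cosine is nonnegative. *)
Lemma shift_part_numrange y :
  `|redot R m.+3 (shift_part y) y| <=
    cos (pi / m.+3%:R) * redot R m.+3 y y.
Proof.
have c0 : 0 <= cos (pi / m.+3%:R : R).
  apply: cos_ge0_pihalf; apply/andP; split.
    by apply: le_trans (_ : 0 <= _); rewrite ?oppr_le0 divr_ge0 ?pi_ge0.
  by rewrite ler_pM2l ?pi_gt0// lef_pV2 ?posrE ?ltr0n// ler_nat.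
rewrite redotxx big_nat_recr//= mulrDr ler_wpDr ?mulr_ge0 ?modulus_ge0//.
apply: le_trans (path_form_le R m.+1 (fun j => modulus (y j))).
rewrite /redot 2?big_nat_recr//= !shift_part0// !mul0r /= !addr0.
apply: le_trans (ler_norm_sum _ _ _) _; apply: ler_sum_nat => j /= jm.
apply: le_trans (ler_norm_Re_mulJ _ _ _) _.
by rewrite /shift_part jm ComplexField.Normc.normcM u1 mul1r mulrC.
Qed.

(** In moduli this is a star form centred at the last coordinate: |a_{n-1}| is the diagonal
    coefficient, and the remaining subdiagonal 1 joins |a_{n-2}| on a common edge. *)
Lemma top_part_numrange y :
  `|redot R m.+3 (top_part y) y| <=
    2^-1 * (modulus (a m.+2) + Num.sqrt (modulus (a m.+2) ^+ 2 +
       ((1 + modulus (a m.+1)) ^+ 2 + \sum_(0 <= j < m.+1) modulus (a j) ^+ 2)))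
    * redot R m.+3 y y.
Proof.
pose c j := modulus (a j) + (j == m.+1)%:R.
have cE (F : nat -> R -> R) :
    \sum_(0 <= j < m.+1) F j (c j) = \sum_(0 <= j < m.+1) F j (modulus (a j)).
  by apply: eq_big_nat => j /= jm; rewrite /c ltn_eqF// addr0.
have cS : c m.+1 = 1 + modulus (a m.+1) by rewrite /c eqxx addrC.
have := @star_form_le R m.+2 (modulus (a m.+2)) (modulus (y m.+2)) c
  (fun j => modulus (y j)) (modulus_ge0 _ _) _.
rewrite !(@big_nat_recr _ _ _ m.+1)//= cS (cE (fun _ r => r ^+ 2)).
rewrite (cE (fun j r => r * modulus (y j))).
rewrite redotxx (@big_nat_recr _ _ _ m.+2)//= (@big_nat_recr _ _ _ m.+1)//=.
set A := \sum_(0 <= j < m.+1) modulus (a j) ^+ 2.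
set Y := \sum_(0 <= j < m.+1) modulus (y j) ^+ 2.
set AY := \sum_(0 <= j < m.+1) _ * _.
have A0 : 0 <= A by apply: sumr_ge0 => j _; exact: sqr_ge0.
rewrite [A + _]addrC [Y + _ + _]addrC => h.
apply: le_trans (h _); last first.
  by rewrite ltr_wpDr// exprn_gt0// ltr_wpDr ?modulus_ge0.
rewrite /redot 2?big_nat_recr//= big_nat big1 => [|j /= jm]; last first.
  by rewrite top_part0// mul0r.
rewrite add0r /top_part eqxx (ltn_eqF (ltnSn _)) eqxx.
apply: le_trans (ler_normD _ _) _.
apply: le_trans (lerD (ler_norm_Re_mulJ _ _ _) (ler_norm_Re_mulJ _ _ _)) _.
rewrite !ComplexField.Normc.normcM u1 !mul1r normcN.
have := modulus_sum_le R m.+3 (fun j => a j * y j).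
under [leRHS]eq_bigr do rewrite ComplexField.Normc.normcM.
rewrite [leRHS]big_nat_recr//= [X in _ <= X + _]big_nat_recr//= -/AY => hS.
have := ler_wpM2r (modulus_ge0 _ (y m.+2)) hS.
lra.
Qed.

(** Again a star centred at the last coordinate, now with zero diagonal: AB puts a_{j-1} on edge
    [j], and BA has a single entry, of modulus 1, on edge [m]. *)
Lemma cross_part_numrange y :
  redot R m.+3 (lincomb R 1 (top_part (shift_part y))
                        1 (shift_part (top_part y))) y <=
    2^-1 * Num.sqrt ((1 + modulus (prev_coef m)) ^+ 2
       + \sum_(0 <= j < m.+1 | j.+1 != m) modulus (a j) ^+ 2)
    * redot R m.+3 y y.
Proof.
pose c j := modulus (prev_coef j) + (j == m)%:R.
have cE (F : nat -> R -> R) :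
    \sum_(0 <= j < m.+2) F j (c j) =
    F m (1 + modulus (prev_coef m))
    + \sum_(0 <= j < m.+2 | j != m) F j (modulus (prev_coef j)).
  rewrite (bigD1_seq m) ?iota_uniq ?mem_index_iota ?ltnS ?leqnSn//=.
  rewrite {1}/c eqxx [_ + 1]addrC; congr (_ + _).
  by apply: eq_bigr => j /negbTE jm; rewrite /c jm addr0.
have c2 : \sum_(0 <= j < m.+2) c j ^+ 2 =
    (1 + modulus (prev_coef m)) ^+ 2
       + \sum_(0 <= j < m.+1 | j.+1 != m) modulus (a j) ^+ 2.
  rewrite (cE (fun _ r => r ^+ 2)); congr (_ + _).
  (* The term of index 0 vanishes whether or not [m = 0], so the sum can be reindexed. *)
  rewrite big_mkcond big_nat_recl// modulus_prev_coef0 expr0n if_same.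
  by rewrite /= add0r [RHS]big_mkcond.
have cpos : 0 < \sum_(0 <= j < m.+2) c j ^+ 2.
  rewrite c2 ltr_wpDr//; last by rewrite exprn_gt0// ltr_wpDr ?modulus_ge0.
  by apply: sumr_ge0 => j _; exact: sqr_ge0.
have := @star_form_le R m.+2 0 (modulus (y m.+2)) c
  (fun j => modulus (y j)) (lexx _) cpos.
rewrite mul0r add0r !expr0n/= !add0r c2 redotxx.
rewrite [X in _ -> _ <= _ * X]big_nat_recr//=.
rewrite [X in _ -> _ <= _ * X]addrC.
apply: le_trans.
rewrite redotl !mul1r.
have hT : redot R m.+3 (top_part (shift_part y)) y <=
    modulus (y m.+2) * \sum_(0 <= j < m.+1) modulus (a j) * modulus (y j.+1).
  rewrite /redot 2?big_nat_recr//= big_nat big1 => [|j /= jm]; last first.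
    by rewrite top_part0// mul0r.
  rewrite add0r /top_part eqxx (ltn_eqF (ltnSn _)) eqxx.
  rewrite (@shift_part0 y m.+2)// mulr0 mul0r add0r.
  apply: le_trans (ler_norm _) _; apply: le_trans (ler_norm_Re_mulJ _ _ _) _.
  rewrite !ComplexField.Normc.normcM u1 !mul1r normcN mulrC.
  apply: ler_wpM2l; first exact: modulus_ge0.
  rewrite 2?big_nat_recr//= !shift_part0// !mulr0 !addr0.
  apply: le_trans (modulus_sum_le _ _ _) _; apply: ler_sum_nat => j /= jm.
  by rewrite /shift_part jm !ComplexField.Normc.normcM u1 mul1r.
have hS : redot R m.+3 (shift_part (top_part y)) y <=
    modulus (y m.+2) * modulus (y m).
  rewrite /redot 3?big_nat_recr//= big_nat big1 => [|j /= jm]; last first.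
    by rewrite /shift_part ltnW// top_part0// mulr0 mul0r.
  rewrite !(@shift_part0 _ _.+1)// !mul0r !addr0 add0r /shift_part ltnSn.
  rewrite /top_part eqSS (ltn_eqF (ltnSn _)) eqxx.
  apply: le_trans (ler_norm _) _; apply: le_trans (ler_norm_Re_mulJ _ _ _) _.
  by rewrite !ComplexField.Normc.normcM u1 !mul1r.
apply: le_trans (lerD hT hS) _; rewrite -mulrDr.
apply: ler_wpM2l; first exact: modulus_ge0.
rewrite /c; under [leRHS]eq_bigr do rewrite mulrDl.
rewrite big_split /= [X in _ <= X + _]big_nat_recl//.
rewrite modulus_prev_coef0 mul0r /= add0r lerD2l.
rewrite (bigD1_seq m) ?iota_uniq ?mem_index_iota ?ltnS ?leqnSn//=.
rewrite eqxx mul1r lerDl; apply: sumr_ge0 => j _.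
by rewrite mulr_ge0 ?modulus_ge0.
Qed.

Lemma modulus_root_le (z : R[i]) : u * z = (modulus z)%:C ->
  z ^+ m.+3 = - \sum_(0 <= j < m.+3) a j * z ^+ j ->
  modulus z ^+ 2 <= cos (pi / m.+3%:R) ^+ 2
    + 4^-1 * (modulus (a m.+2) + Num.sqrt (modulus (a m.+2) ^+ 2 +
       ((1 + modulus (a m.+1)) ^+ 2
        + \sum_(0 <= j < m.+1) modulus (a j) ^+ 2))) ^+ 2
    + 2^-1 * Num.sqrt ((1 + modulus (prev_coef m)) ^+ 2
       + \sum_(0 <= j < m.+1 | j.+1 != m) modulus (a j) ^+ 2).
Proof.
set r := modulus z => uz hz.
(* Truncating by 0 makes the eigenvector equation hold as an equality of functions on [nat]. *)
pose x j := if (j < m.+3)%N then z ^+ j else 0.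
have eigen : lincomb R 1 (top_part x) 1 (shift_part x) = lincomb R r x 0 x.
  apply/funext => i; rewrite /lincomb !mul1r mul0r addr0 -uz.
  have S : \sum_(0 <= j < m.+3) a j * x j = \sum_(0 <= j < m.+3) a j * z ^+ j.
    by apply: eq_big_nat => j /= jm; rewrite /x jm.
  have [im|] := ltnP i m.+1.
    rewrite top_part0// add0r /shift_part im /x ltnW// ltnW// ?exprS ?mulrA//.
    by rewrite ltnW.
  move=> mi; rewrite shift_part0// addr0 /top_part S -hz /x.
  case: eqP => [->|/eqP ni2]; first by rewrite ltnSn exprS mulrA.
  case: eqP => [->|/eqP ni1]; first by rewrite leqnn ltnW// exprS mulrA.
  rewrite ltnNge ltn_neqAle eq_sym ni2 ltn_neqAle eq_sym ni1 mi /=.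
  by rewrite mulr0.
have square : r ^+ 2 * redot R m.+3 x x =
    redot R m.+3 (top_part (top_part x)) x
    + redot R m.+3 (lincomb R 1 (top_part (shift_part x))
                            1 (shift_part (top_part x))) x
    + redot R m.+3 (shift_part (shift_part x)) x.
  (* The claim is [e1] plus [e2] plus [r] times [e0]. *)
  have e0 := congr1 (fun v => redot R m.+3 v x) eigen.
  have e1 := congr1 (fun v => redot R m.+3 (top_part v) x) eigen.
  have e2 := congr1 (fun v => redot R m.+3 (shift_part v) x) eigen.
  move: e0 e1 e2; rewrite /= !top_part_linear !shift_part_linear !redotl.
  nra.
have xx : 0 < redot R m.+3 x x.
  rewrite redotxx big_nat_recl// /x expr0 ltr_pwDl//.
    by rewrite ComplexField.Normc.normc1 expr1n.
  by apply: sumr_ge0 => j _; exact: sqr_ge0.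
rewrite -(ler_pM2r xx) square mulrDl mulrDl addrAC.
apply: lerD; last exact: cross_part_numrange.
rewrite addrC; apply: lerD.
  apply: numerical_radius_sqr; [exact: shift_part_linear| |].
    (* Strict positivity holds because n >= 3 gives pi / n < pi / 2. *)
    apply: cos_gt0_pihalf; apply/andP; split.
      by apply: lt_trans (_ : 0 < _); rewrite ?oppr_lt0 divr_gt0 ?pi_gt0.
    by rewrite ltr_pM2l ?pi_gt0// ltf_pV2 ?posrE ?ltr0n// ltr_nat.
  exact: shift_part_numrange.
have -> : 4^-1 = 2^-1 ^+ 2 :> R by rewrite expr2; lra.
rewrite -exprMn; apply: numerical_radius_sqr; first exact: top_part_linear.
  rewrite mulr_gt0 ?invr_gt0// ltr_wpDl ?modulus_ge0// sqrtr_gt0.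
  rewrite ltr_wpDl ?sqr_ge0// ltr_pwDl//.
    by rewrite exprn_gt0// ltr_wpDr ?modulus_ge0.
  by apply: sumr_ge0 => j _; exact: sqr_ge0.
exact: top_part_numrange.
Qed.

End CompanionMatrix.

Theorem theorem2p7 (R : realType) (n : nat) (p : {poly R[i]}) (z : R[i])
    (hn : (3 <= n)%N) (hmonic : p \is monic) (hdeg : size p = n.+1)
    (ha0 : p`_0 != 0) (hz : root p z) :
  modulus z ^+ 2 <=
    cos (pi / n%:R) ^+ 2
    + 4^-1 * (modulus p`_(n - 1)
              + Num.sqrt ((1 + modulus p`_(n - 2)) ^+ 2
                          + \sum_(0 <= j < n | j != (n - 2)%N)
                              modulus p`_j ^+ 2)) ^+ 2
    + 2^-1 * Num.sqrt ((1 + modulus (coefz p (n%:Z - 4))) ^+ 2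
                       + \sum_(0 <= j < n - 2 | j%:Z != n%:Z - 4)
                           modulus p`_j ^+ 2).
Proof.
case: n hn hdeg => [|[|[|m]]]// _ hdeg.
have hz' : z ^+ m.+3 = - \sum_(0 <= j < m.+3) p`_j * z ^+ j.
  move: hmonic hz => /monicP; rewrite lead_coefE hdeg /= => pm /rootP.
  rewrite horner_coef hdeg big_ord_recr /= pm mul1r.
  rewrite -(big_mkord predT (fun j => p`_j * z ^+ j)).
  by move/eqP; rewrite addrC addr_eq0 => /eqP.
(* [u] is |z| / z, or 1 when z = 0. *)
have [u u1 uz] : exists2 u : R[i], modulus u = 1 & u * z = (modulus z)%:C%C.
  have [->|z0] := eqVneq z 0.
    exists 1; first exact: ComplexField.Normc.normc1.
    by rewrite mulr0 ComplexField.Normc.normc0.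
  have mz : modulus z != 0.
    by apply: contra_neq z0 => /ComplexField.Normc.eq0_normc.
  exists ((modulus z)%:C%C / z); last by rewrite divfK.
  rewrite ComplexField.Normc.normcM ComplexField.Normc.normcV /=.
  by rewrite expr0n addr0 sqrtr_sqr ger0_norm ?modulus_ge0// divff.
have := @modulus_root_le R m (fun j => p`_j) u u1 z uz hz'.
rewrite subn1 !subSS !subn0 /=.
have -> : \sum_(0 <= j < m.+3 | j != m.+1) modulus p`_j ^+ 2 =
    modulus p`_m.+2 ^+ 2 + \sum_(0 <= j < m.+1) modulus p`_j ^+ 2.
  rewrite big_mkcond 2?big_nat_recr//= eqxx addr0 gtn_eqF// addrC.
  by congr (_ + _); apply: eq_big_nat => j /= jm; rewrite ltn_eqF.
rewrite [modulus p`_m.+2 ^+ 2 + (_ + _)]addrCA.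
have -> : coefz p (m.+3%:Z - 4) = prev_coef R (fun j => p`_j) m.
  (* For [m = 0] the index is -1 and both sides are 0 by definition. *)
  case: m {hdeg hz'} => [//|k].
  by have -> : k.+4%:Z - 4 = k%:Z by lia.
have -> // : \sum_(0 <= j < m.+1 | j%:Z != m.+3%:Z - 4) modulus p`_j ^+ 2 =
  \sum_(0 <= j < m.+1 | j.+1 != m) modulus p`_j ^+ 2.
(* For [m = 0] neither condition excludes any index. *)
apply: eq_bigl => j; apply/negP/negP; lia.
Qed.
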